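(* For fixed $k\in\{1,\dots,n-1\}$, the number of boolean intervals $[\sigma_k,w]_{\mathrm{wk}}$ (with $w\in\mathfrak{S}_n$, $\sigma_k\le_{\mathrm{wk}}w$) in the weak order on $\mathfrak{S}_n$ is $F_{k+1}F_{n-k+1}$, where $F_i$ is the $i$th Fibonacci number.
   Context: $\mathfrak{S}_n$ is the symmetric group with Coxeter generators $\sigma_1,\dots,\sigma_{n-1}$, where $\sigma_i$ is the transposition swapping $i$ and $i+1$. A reduced decomposition of $w$ is a word of minimal length in these generators with product $w$. (Right) weak order: $v\le_{\mathrm{wk}}w$ if some reduced decomposition of $v$ is a prefix of a reduced decomposition of $w$. $[v,w]_{\mathrm{wk}}=\{u: v\le_{\mathrm{wk}}u\le_{\mathrm{wk}}w\}$ for $v\le_{\mathrm{wk}}w$. A poset is boolean if it is isomorphic to the poset of all subsets of a finite set, ordered by inclusion. Fibonacci numbers are indexed by $F_0=0$, $F_1=1$. *)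

(* Defs.v *)
From mathcomp Require Import all_boot all_fingroup.
From mathcomp Require Import boolp.

Set Implicit Arguments.
Unset Strict Implicit.
Unset Printing Implicit Defensive.

Fixpoint fib (m : nat) : nat :=
  match m with
  | 0 => 0
  | S p => match p with 0 => 1 | S q => fib p + fib q end
  end.

(* Indices 1, ..., n-1 of the Coxeter generators of 'S_n. *)
Definition gen (n : nat) := {i : nat | 0 < i < n}.

Lemma gen_ltn n (i : gen n) : val i < n.
Proof. by case/andP: (valP i). Qed.

Lemma gen_pred_ltn n (i : gen n) : (val i).-1 < n.
Proof. exact: leq_ltn_trans (leq_pred _) (gen_ltn i). Qed.

(* 'S_n permutes {0, ..., n-1}, so the points i and i+1 of the usual
   {1, ..., n} are encoded as i-1 and i. *)
Definition sigma (n : nat) (i : gen n) : 'S_n :=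
  tperm (Ordinal (gen_pred_ltn i)) (Ordinal (gen_ltn i)).

(* The product is the group law of 'S_n, which composes from left to right;
   the other convention amounts to applying the group isomorphism w |-> w^-1
   onto the opposite group, which fixes every generator. *)
Definition word_prod (n : nat) (s : seq (gen n)) : 'S_n :=
  (\prod_(i <- s) sigma i)%g.

Definition reduced_decomposition (n : nat) (w : 'S_n) (s : seq (gen n)) : Prop :=
  word_prod s = w /\ forall t, word_prod t = w -> size s <= size t.

Definition wk_le (n : nat) (v w : 'S_n) : Prop :=
  exists s t, [/\ reduced_decomposition v s, reduced_decomposition w t
                & prefix s t].

Definition wk_interval (n : nat) (v w : 'S_n) : {set 'S_n} :=
  [set u | `[< wk_le v u /\ wk_le u w >]].

Definition boolean_poset (T : finType) (le : T -> T -> Prop) (A : {set T}) :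
    Prop :=
  exists (X : finType) (f : T -> {set X}),
    [/\ {in A &, injective f},
        f @: A = [set: {set X}]
      & {in A &, forall u v, le u v <-> f u \subset f v}].

(* Main.v *)
(** The length of [w] is its number of inversions, and weak order is inclusion
    of the sets [inv w] of inverted pairs of positions. For [v] fixed, the
    boolean intervals [[v, w]] correspond to the sets [J] of pairwise
    nonadjacent ascents of [v]: [w] is [v] times the product of the commuting
    generators in [J], which adds to [inv v] exactly one pair for each element
    of [J]. For [v = sigma_k] the ascents are all the indices but [k], so [J] is
    a pair of binary words without two adjacent ones, of lengths [k - 1] and
    [n - k - 1], and Fibonacci numbers count such words. *)

Require Import Defs.
From mathcomp Require Import all_boot all_fingroup.
From mathcomp Require Import boolp.
From mathcomp Require Import zify.

Set Implicit Arguments.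
Unset Strict Implicit.
Unset Printing Implicit Defensive.

Section Inversions.

Local Open Scope group_scope.

Variable n : nat.
Implicit Types (u v w : 'S_n) (a b c : 'I_n) (x : 'I_n * 'I_n).

(** * Inversion sets and transpositions of consecutive values *)

Definition inv w : {set 'I_n * 'I_n} :=
  [set x : 'I_n * 'I_n | (x.1 < x.2) && (w x.2 < w x.1)].

Definition len w := #|inv w|.

Lemma in_inv w a b : ((a, b) \in inv w) = (a < b) && (w b < w a).
Proof. by rewrite inE. Qed.

Lemma inv1 : inv 1 = set0.
Proof. by apply/setP=> x; rewrite !inE !perm1; lia. Qed.

Lemma len1 : len 1 = 0.
Proof. by rewrite /len inv1 cards0. Qed.

(** Products compose from left to right, so the values at [a] and [b] are exchanged. They are
    consecutive, hence any third value compares alike with both, and only [(a, b)] changes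
    status. *)
Lemma inv_tpermM w a b : a < b -> w b = (w a).+1 :> nat ->
  inv (tperm a b * w) = (a, b) |: inv w.
Proof.
move=> ab wab; apply/setP=> -[c d]; rewrite !inE /= !permM xpair_eqE.
have neq e f : (e == f) = (w e == w f :> nat).
  by rewrite (inj_eq val_inj) (inj_eq perm_inj).
have neqv (e f : 'I_n) : (e == f) = (e == f :> nat) by [].
have := neq c a; have := neq c b; have := neq d a; have := neq d b.
have := neq c d.
case: tpermP => [->|->|/eqP hd1 /eqP hd2];
  case: tpermP => [->|->|/eqP hc1 /eqP hc2];
  rewrite ?eqxx ?(negPf hd1) ?(negPf hd2) ?(negPf hc1) ?(negPf hc2) ?neqv; lia.
Qed.

Lemma notin_inv_cover w a b : w b = (w a).+1 :> nat -> (a, b) \notin inv w.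
Proof. by move=> wab; rewrite in_inv wab; lia. Qed.

(** Conjugation by [w] turns the generator, which exchanges two consecutive values, into the
    transposition of the positions that hold them. *)
Lemma mul_sigma w (i : gen n) : exists a b,
  [/\ w b = (w a).+1 :> nat, w * sigma i = tperm a b * w & val i = w b].
Proof.
exists (w^-1 (Ordinal (gen_pred_ltn i))), (w^-1 (Ordinal (gen_ltn i))).
rewrite !permKV /=; split=> //.
  by rewrite prednK //; case/andP: (valP i).
by rewrite -tpermJ conjgE invgK mulgA mulgKV.
Qed.

Lemma cover_sigma w a b : w b = (w a).+1 :> nat ->
  exists i : gen n, w * sigma i = tperm a b * w.
Proof.
move=> wab.
have hi : 0 < w b < n by rewrite ltn_ord wab.
exists (exist _ (val (w b)) hi).
have [a' [b' [wab' -> /= e]]] := mul_sigma w (exist _ (val (w b)) hi).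
have -> : b' = b by apply: (@perm_inj _ w); apply: val_inj.
suff -> : a' = a by [].
by apply: (@perm_inj _ w); apply: val_inj; move: wab' wab => /=; lia.
Qed.

Lemma adj_increasing_perm u :
  (forall i j : 'I_n, j = i.+1 :> nat -> u i < u j) -> u = 1.
Proof.
move=> inc; apply/permP=> i; rewrite perm1; apply: val_inj => /=.
(* [le] climbs from position 0 and [ge] descends from the last position; together they squeeze [u i]
   to [i]. *)
have le m : forall i : 'I_n, i = m :> nat -> m <= u i.
  elim: m => // m IH j jm.
  have hm : m < n by have := ltn_ord j; lia.
  have := inc (Ordinal hm) j jm; have := IH (Ordinal hm) erefl; lia.
have ge m : forall i : 'I_n, (i + m).+1 = n -> u i + m < n.
  elim: m => [|m IH] j jm; first by have := ltn_ord (u j); lia.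
  have hm : j.+1 < n by lia.
  have := inc j (Ordinal hm) erefl; have := IH (Ordinal hm).
  rewrite /=; lia.
have := le _ i erefl; have := ge (n - i.+1) i; have := ltn_ord i; lia.
Qed.

(* A descent of [v^-1 * w] gives two consecutive values of [v] whose positions
   are inverted by [w]; as [inv v \subset inv w], they are not inverted by
   [v]. *)
Lemma exists_cover v w : inv v \subset inv w -> v <> w ->
  exists a b, [/\ a < b, v b = (v a).+1 :> nat & (a, b) \in inv w].
Proof.
move=> /subsetP sub neq; apply: contrapT => none; apply: neq.
apply/eqP; rewrite eq_sym -(inj_eq (mulgI v^-1)) mulVg; apply/eqP.
apply: adj_increasing_perm => i j ij.
rewrite ltnNge leq_eqVlt; apply/negP=> /orP[/eqP/val_inj/perm_inj eij|].
  by move: ij; rewrite eij; lia.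
rewrite !permM => lt; set a := v^-1 i in lt; set b := v^-1 j in lt.
have va : v a = i by rewrite permKV.
have vb : v b = j by rewrite permKV.
case: (ltngtP a b) => [ab|ba|/val_inj ab].
- by apply: none; exists a, b; rewrite in_inv ab lt va vb.
- have := sub (b, a); rewrite !in_inv ba va vb ij ltnSn => /(_ isT) /=; lia.
- by move: lt; rewrite ab; lia.
Qed.

(** * Weak order as inclusion of inversion sets *)

Lemma word_prod_cons (i : gen n) t :
  word_prod (i :: t) = sigma i * word_prod t.
Proof. by rewrite /word_prod big_cons. Qed.

(** The relative order of the two positions decides: either their pair is a new inversion, or [v]
    itself arises from the product by adding that pair. *)
Lemma len_mul_sigma v (i : gen n) :
  len (v * sigma i) <= (len v).+1 ?= iff (inv v \proper inv (v * sigma i)).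
Proof.
have [a [b [vab -> _]]] := mul_sigma v i.
have nab := notin_inv_cover vab.
case: (ltngtP a b) => [ab|ba|/val_inj ab].
- apply/leqifP.
  rewrite (inv_tpermM ab vab) properUr ?sub1set //.
  by rewrite /len (inv_tpermM ab vab) cardsU1 nab add1n.
- set w := tperm a b * v.
  have inv_v : inv v = (b, a) |: inv w.
    have -> : v = tperm b a * w by rewrite /w mulgA tpermC tperm2 mul1g.
    by apply: inv_tpermM => //; rewrite !permM tpermL tpermR.
  have le : len w <= len v by rewrite /len subset_leq_card // inv_v subsetUr.
  apply/leqifP; case: ifP => // /proper_card lt.
  by rewrite ltnNge -/(len _) le in lt.
- by move: vab; rewrite ab; lia.
Qed.

(** Each letter adds at most one inversion, so equality forces every letter to add one, and then the
    inversion sets grow along the word. *)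
Lemma len_mul_word v t :
  len (v * word_prod t) <= len v + size t /\
  (len (v * word_prod t) = len v + size t ->
   inv v \subset inv (v * word_prod t)).
Proof.
elim: t v => [|i t IH] v.
  by rewrite /word_prod big_nil mulg1 addn0.
have -> : v * word_prod (i :: t) = v * sigma i * word_prod t.
  by rewrite word_prod_cons mulgA.
have [le sub] := IH (v * sigma i).
have [le1 eq1] := len_mul_sigma v i.
rewrite /=; split=> [|eq]; first lia.
apply: subset_trans (proper_sub _) (sub _); last lia.
by rewrite -eq1; apply/eqP; lia.
Qed.

(** A climb by covers: the pair added at each step is taken inside [inv w], so the inclusion
    persists while the gap in length drops by one. *)
Lemma inv_sub_word v w : inv v \subset inv w ->
  exists2 t, w = v * word_prod t & len w = len v + size t.
Proof.
have [m] := ubnP (len w - len v); elim: m v => // m IH v ltm sub.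
have [<-|/eqP neq] := eqVneq v w.
  by exists [::]; rewrite ?addn0 // /word_prod big_nil mulg1.
have [a [b [ab vab wab]]] := exists_cover sub neq.
have [i vi] := cover_sigma vab.
have inv_vi : inv (v * sigma i) = (a, b) |: inv v by rewrite vi inv_tpermM.
have card_vi : len (v * sigma i) = (len v).+1.
  by rewrite /len inv_vi cardsU1 notin_inv_cover.
have sub_vi : inv (v * sigma i) \subset inv w by rewrite inv_vi subUset sub1set wab.
have le_vi : len (v * sigma i) <= len w by rewrite subset_leq_card.
have [|t wt cw] := IH _ _ sub_vi; first lia.
by exists (i :: t); rewrite ?word_prod_cons ?mulgA //=; lia.
Qed.

Lemma reducedP w s :
  reduced_decomposition w s <-> word_prod s = w /\ size s = len w.
Proof.
have ge t : word_prod t = w -> len w <= size t.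
  by move=> <-; have [] := len_mul_word 1 t; rewrite mul1g len1.
split=> -[ws sz]; split=> //; last by move=> t /ge; rewrite sz.
have [|t wt ct] := @inv_sub_word 1 w; first by rewrite inv1 sub0set.
have := sz t; rewrite -[word_prod t]mul1g -wt => /(_ erefl).
by have := ge _ ws; rewrite ct len1; lia.
Qed.

(** Reduced words give the equality case of [len_mul_word]. Conversely, a reduced word of [v] is
    extended by a climb from [v] to [w]. *)
Lemma wk_leP v w : wk_le v w <-> inv v \subset inv w.
Proof.
split=> [[s [t [/reducedP[vs ss] /reducedP[wt st] /prefixP[r tr]]]]|sub].
  have wr : w = v * word_prod r by rewrite -vs -wt tr /word_prod big_cat.
  have [_] := len_mul_word v r; rewrite -wr; apply.
  by rewrite -st tr size_cat ss.
have [|s vs cs] := @inv_sub_word 1 v; first by rewrite inv1 sub0set.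
have [r wr cr] := inv_sub_word sub.
move: vs cs; rewrite len1 mul1g => vs cs.
exists s, (s ++ r); split; last exact: prefix_prefix.
  by apply/reducedP.
apply/reducedP; split; last by rewrite size_cat cr cs.
by rewrite wr vs /word_prod big_cat.
Qed.

Lemma inv_inj : injective inv.
Proof.
move=> v w e; have [|t wt] := @inv_sub_word v w; first by rewrite e.
rewrite /len e => ct; have /size0nil t0 : size t = 0 by lia.
by rewrite wt t0 /word_prod big_nil mulg1.
Qed.

(** * Boolean intervals and nonadjacent ascents *)

Lemma in_wk_interval v w u :
  (u \in wk_interval v w) = (inv v \subset inv u) && (inv u \subset inv w).
Proof. by rewrite inE; apply/asboolP/andP; rewrite !wk_leP => -[]. Qed.

(** Indices are the smaller of two consecutive values counted from 0, so [i] stands for the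
    generator [i.+1]. Only the ascents in [J] contribute. *)
Definition cover_inv v (J : pred nat) : {set 'I_n * 'I_n} :=
  [set x : 'I_n * 'I_n |
    [&& x.1 < x.2, v x.2 == (v x.1).+1 :> nat & J (v x.1)]].

Lemma in_cover_inv v J a b : ((a, b) \in cover_inv v J) =
  [&& a < b, v b == (v a).+1 :> nat & J (v a)].
Proof. by rewrite inE. Qed.

(** Equivalently, right multiplication by the generator [i.+1] lengthens [v]. *)
Definition ascent v i : bool := [exists x : 'I_n * 'I_n,
  [&& x.1 < x.2, v x.1 == i :> nat & v x.2 == i.+1 :> nat]].

Lemma ascentP v i : reflect
  (exists a b, [/\ a < b, v a = i :> nat & v b = i.+1 :> nat]) (ascent v i).
Proof.
apply: (iffP existsP) => [[[a b] /and3P[/= ab /eqP va /eqP vb]]|].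
  by exists a, b.
by move=> [a [b [ab va vb]]]; exists (a, b); rewrite /= ab va vb !eqxx.
Qed.

Lemma perm_val_inj v a b : v a = v b :> nat -> a = b.
Proof. by move=> /val_inj/perm_inj. Qed.

Lemma exists_inv_setU_cover v (J : pred nat) :
  (forall i, ~~ (J i && J i.+1)) ->
  exists w, inv w = inv v :|: cover_inv v J.
Proof.
move=> nadj.
(* Multiply by the commuting generators one at a time; the second conjunct
   says that the values not yet moved are still at their positions in [v]. *)
have step m : exists w,
    inv w = inv v :|: cover_inv v [pred i | J i && (i < m)] /\
    forall a, ~~ (J (v a) && (v a < m)) ->
      ~~ [&& 0 < v a, J (v a).-1 & (v a).-1 < m] -> w a = v a.
  elim: m => [|m [w [inv_w fix_w]]].
    exists v; split=> //; apply/setP=> -[a b].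
    by rewrite in_setU in_cover_inv /=; lia.
  have [/andP[Jm /ascentP[a [b [ab va vb]]]]|no] := boolP (J m && ascent v m).
    (* As [m.-1] is not in [J], the values [m] and [m.+1] are still at [a] and [b] in [w], so the
       transposition adds exactly [(a, b)]. *)
    have Jpred : 0 < m -> ~~ J m.-1.
      by move=> m0; have := nadj m.-1; rewrite prednK // Jm andbT.
    have Jsucc : ~~ J m.+1 by have := nadj m; rewrite Jm.
    have wa : w a = v a by apply: fix_w; rewrite va; lia.
    have wb : w b = v b by apply: fix_w; rewrite vb /=; lia.
    exists (tperm a b * w); split.
      rewrite inv_tpermM ?wa ?wb ?va ?vb // inv_w setUCA; congr (_ :|: _).
      apply/setP=> -[c d]; rewrite in_setU1 !in_cover_inv /= xpair_eqE.
      apply/orP/and4P => [[/andP[/eqP-> /eqP->]|/and4P[-> -> -> lt]]|].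
      - by rewrite va vb Jm.
      - by split=> //; lia.
      - move=> [cd /eqP vd Jc]; rewrite ltnS leq_eqVlt => /orP[/eqP vc|lt].
          left; have -> : c = a by apply: (@perm_val_inj v); rewrite vc.
          suff -> : d = b by rewrite !eqxx.
          by apply: (@perm_val_inj v); rewrite vd vc vb.
        by right; rewrite cd vd eqxx Jc.
    move=> c h1 h2; rewrite permM tpermD; last 2 first.
    - by apply/eqP=> e; move: h1; rewrite -e va Jm ltnSn.
    - by apply/eqP=> e; move: h2; rewrite -e vb /= Jm ltnSn.
    by apply: fix_w; lia.
  exists w; split=> [|a h1 h2]; last by apply: fix_w; lia.
  rewrite inv_w; congr (_ :|: _); apply/setP=> -[a b]; rewrite !in_cover_inv /=.
  apply/and4P/and4P => -[ab vb Ja lt]; split=> //; first lia.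
  move: lt; rewrite ltnS leq_eqVlt => /orP[/eqP va|//].
  case/negP: no; rewrite -va Ja; apply/ascentP.
  by exists a, b; split=> //; apply/eqP.
have [w [inv_w _]] := step n; exists w; rewrite inv_w; congr (_ :|: _).
by apply/setP=> -[a b]; rewrite !in_cover_inv /= ltn_ord andbT.
Qed.

(** An element of the interval is recorded by the pairs it adds to [inv v]. Any set of these pairs
    comes from a subset of [J], still nonadjacent, hence is attained. *)
Lemma boolean_wk_interval v w (J : pred nat) :
  (forall i, ~~ (J i && J i.+1)) -> inv w = inv v :|: cover_inv v J ->
  boolean_poset (@wk_le n) (wk_interval v w).
Proof.
move=> nadj inv_w.
pose X := {x : 'I_n * 'I_n | x \in cover_inv v J}.
pose f u : {set X} := [set x | val x \in inv u].
have in_f u (x : X) : (x \in f u) = (val x \in inv u) by rewrite /f in_set.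
have f_mono : {in wk_interval v w &, forall u1 u2,
    (f u1 \subset f u2) = (inv u1 \subset inv u2)}.
  move=> u1 u2; rewrite !in_wk_interval inv_w => /andP[_ /subsetP u1w] /andP[vu2 _].
  apply/subsetP/subsetP => [sub x xu1|sub x]; last by rewrite !in_f; apply: sub.
  have := u1w _ xu1; rewrite in_setU => /orP[|xJ]; first exact: (subsetP vu2).
  by have := sub (Sub x xJ); rewrite !in_f SubK; apply.
exists X, f; split.
- move=> u1 u2 hu1 hu2 e; apply: inv_inj; apply/eqP.
  by rewrite eqEsubset -!f_mono // e subxx.
- apply/setP=> B; rewrite inE; apply/imsetP.
  pose JB i := [exists x in B, v (val x).1 == i :> nat].
  have JBJ i : JB i -> J i.
    move=> /existsP[x /andP[_ /eqP <-]].
    by have := valP x; rewrite inE => /and3P[].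
  have [u inv_u] : exists u, inv u = inv v :|: cover_inv v JB.
    apply: exists_inv_setU_cover => i; apply: contra (nadj i).
    by case/andP=> /JBJ-> /JBJ->.
  exists u.
    rewrite in_wk_interval inv_u inv_w subsetUl setUS //.
    by apply/subsetP=> x; rewrite !inE => /and3P[-> -> /JBJ].
  apply/setP=> -[x xJ]; rewrite in_f /= inv_u in_setU.
  case: x xJ => a b xJ; have := xJ; rewrite in_cover_inv => /and3P[ab /eqP vb Ja].
  rewrite (negPf (notin_inv_cover vb)) in_cover_inv ab vb eqxx /=.
  apply/idP/existsP => [xB|[[[c d] yJ] /andP[yB /= /eqP vc]]].
    by exists (exist _ (a, b) xJ); rewrite xB /=.
  have := yJ; rewrite in_cover_inv => /and3P[_ /eqP vd _].
  have ca : c = a := perm_val_inj vc.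
  have db : d = b by apply: (@perm_val_inj v); rewrite vb vd vc.
  move: yJ yB; rewrite ca db => yJ.
  by rewrite (bool_irrelevance yJ xJ).
- by move=> u1 u2 h1 h2; rewrite wk_leP f_mono.
Qed.

(** In a boolean interval the top is the join of the atoms; [J] collects the indices of the
    atoms. *)
Lemma boolean_wk_interval_cover v w :
  wk_le v w -> boolean_poset (@wk_le n) (wk_interval v w) ->
  exists J : pred nat,
    [/\ forall i, J i -> ascent v i, forall i, ~~ (J i && J i.+1)
       & inv w = inv v :|: cover_inv v J].
Proof.
move=> /wk_leP vw [X [f [_ f_surj f_le]]].
have f_mono : {in wk_interval v w &, forall u1 u2,
    (f u1 \subset f u2) = (inv u1 \subset inv u2)}.
  by move=> u1 u2 h1 h2; apply/idP/idP; rewrite -wk_leP f_le.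
have f_onto B : exists2 u, u \in wk_interval v w & f u = B.
  have : B \in f @: wk_interval v w by rewrite f_surj inE.
  by case/imsetP=> u hu ->; exists u.
have v_in : v \in wk_interval v w by rewrite in_wk_interval subxx vw.
have w_in : w \in wk_interval v w by rewrite in_wk_interval subxx vw.
have cover_in a b : a < b -> v b = (v a).+1 :> nat -> (a, b) \in inv w ->
    tperm a b * v \in wk_interval v w.
  move=> ab vab abw.
  by rewrite in_wk_interval inv_tpermM // subsetUr subUset sub1set abw vw.
pose J i := [exists x in inv w,
  [&& x.1 < x.2, v x.1 == i :> nat & v x.2 == i.+1 :> nat]].
have JP i : J i -> exists a b,
    [/\ a < b, v a = i :> nat, v b = i.+1 :> nat & (a, b) \in inv w].
  by case/existsP=> -[a b] /and4P[abw /= ab /eqP va /eqP vb]; exists a, b.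
have J_sub : cover_inv v J \subset inv w.
  apply/subsetP=> -[a b]; rewrite in_cover_inv => /and3P[ab /eqP vb /JP].
  move=> [c [d [cd vc vd]]].
  have -> : c = a := perm_val_inj vc.
  by have -> : d = b by apply: (@perm_val_inj v); rewrite vd vb.
have nadj i : ~~ (J i && J i.+1).
  (* If [i] and [i+1] were both in [J], the join of the atoms [A = v s_i] and
     [B = v s_(i+1)] would also lie above [C = v s_i s_(i+1)], hence
     [f C \subset f A :|: f B]; but [A < C], while [v] is the only
     element of the interval below both [B] and [C]. *)
  apply/negP=> /andP[/JP[a [b [ab va vb abw]]] /JP[b' [c [bc vb' vc bcw]]]].
  have eb : b' = b by apply: (@perm_val_inj v); rewrite vb' vb.
  rewrite {b' vb'}eb in bc bcw.
  have vab : v b = (v a).+1 :> nat by rewrite va vb.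
  have vbc : v c = (v b).+1 :> nat by rewrite vc vb.
  have ac : a < c := ltn_trans ab bc.
  have nac : (a, c) \notin inv v by rewrite in_inv va vc; lia.
  have inv_trans u : (a, b) \in inv u -> (b, c) \in inv u -> (a, c) \in inv u.
    by rewrite !in_inv; lia.
  set A := tperm a b * v; set B := tperm b c * v; set C := tperm a c * A.
  have inv_A : inv A = (a, b) |: inv v by rewrite inv_tpermM.
  have inv_B : inv B = (b, c) |: inv v by rewrite inv_tpermM.
  have neq (d e : 'I_n) : d < e -> (d == e = false) * (e == d = false).
    by move=> de; split; apply/eqP=> eq_de; move: de; rewrite eq_de ltnn.
  have Aac : A c = (A a).+1 :> nat.
    by rewrite !permM tpermL tpermD ?(neq _ _ ac) ?(neq _ _ bc).
  have inv_C : inv C = (a, c) |: ((a, b) |: inv v) by rewrite inv_tpermM ?inv_A.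
  have A_in : A \in wk_interval v w by apply: cover_in.
  have B_in : B \in wk_interval v w by apply: cover_in.
  have C_in : C \in wk_interval v w.
    rewrite in_wk_interval inv_C !subUset !sub1set abw vw (inv_trans _ abw bcw).
    by rewrite setUA subsetUr.
  have [u u_in fu] := f_onto (f A :|: f B).
  have : inv A \subset inv u by rewrite -f_mono // fu subsetUl.
  have : inv B \subset inv u by rewrite -f_mono // fu subsetUr.
  rewrite inv_A inv_B !subUset !sub1set => /andP[bcu vu] /andP[abu _].
  have fCu : f C \subset f A :|: f B.
    by rewrite -fu f_mono // inv_C !subUset !sub1set abu vu inv_trans.
  have /subsetPn[y yC yA] : ~~ (f C \subset f A).
    rewrite f_mono // inv_A inv_C subUset sub1set negb_and in_setU1.
    by rewrite xpair_eqE !(neq _ _ bc) andbF nac.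
  have yB : y \in f B.
    by have := subsetP fCu _ yC; rewrite in_setU (negPf yA).
  have [z z_in fz] := f_onto [set y].
  have : inv z \subset inv B by rewrite -f_mono // fz sub1set.
  have : inv z \subset inv C by rewrite -f_mono // fz sub1set.
  move=> /subsetP zC /subsetP zB.
  have zv : inv z \subset inv v.
    apply/subsetP=> x xz; have := zC _ xz; have := zB _ xz.
    rewrite inv_B inv_C !in_setU1 => /orP[/eqP->|//].
    by rewrite !xpair_eqE !(neq _ _ ab).
  case/negP: yA; have zA : inv z \subset inv A.
    by apply: subset_trans zv _; rewrite inv_A subsetUr.
  by move: zA; rewrite -f_mono // fz sub1set.
exists J; split=> //.
  by move=> i /JP[a [b [ab va vb _]]]; apply/ascentP; exists a, b.
have [t inv_t] := exists_inv_setU_cover v nadj.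
have tw : inv t \subset inv w by rewrite inv_t subUset vw.
have vt : inv v \subset inv t by rewrite inv_t subsetUl.
have t_in : t \in wk_interval v w by rewrite in_wk_interval vt.
(* If [y] were missing from [f t], the element [z] with image [[set y]] would lie above a cover of
   [v] indexed by [J]. The image of that cover contains [y], yet the cover lies below [t]. *)
rewrite -inv_t; apply/eqP; rewrite eqEsubset tw andbT -f_mono //.
apply/subsetP=> y yw; apply/negPn/negP=> yt.
have [z z_in fz] := f_onto [set y].
have yv : y \notin f v.
  by apply: contra yt; apply: subsetP; rewrite f_mono.
have [vz zw] : inv v \subset inv z /\ inv z \subset inv w.
  by apply/andP; rewrite -in_wk_interval.
have vneqz : v <> z by move=> vz'; move: yv; rewrite vz' fz set11.
have [a [b [ab vab abz]]] := exists_cover vz vneqz.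
have abw : (a, b) \in inv w := subsetP zw _ abz.
have A_in := cover_in _ _ ab vab abw.
have Az : f (tperm a b * v) \subset [set y].
  by rewrite -fz f_mono // inv_tpermM // subUset sub1set abz vz.
have Jab : J (v a).
  by apply/existsP; exists (a, b); rewrite abw /= ab vab !eqxx.
have At : f (tperm a b * v) \subset f t.
  rewrite f_mono // inv_tpermM // subUset sub1set vt inv_t in_setU.
  by rewrite in_cover_inv ab vab eqxx Jab orbT.
have : ~~ (f (tperm a b * v) \subset f v).
  rewrite f_mono // inv_tpermM // subUset sub1set negb_and.
  by rewrite notin_inv_cover.
case/subsetPn=> y' y'A _; case/negP: yt.
have := subsetP Az _ y'A; rewrite inE => /eqP <-; exact: (subsetP At).
Qed.

(** * Encoding boolean intervals by binary words *)

Lemma ascent_ltn v i : ascent v i -> i < n.-1.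
Proof. by case/ascentP=> a [b [_ _ vb]]; have := ltn_ord (v b); lia. Qed.

Lemma card_boolean_wk_intervals v (L : seq bitseq) : uniq L ->
  (forall b : bitseq, b \in L <->
     [/\ size b = n.-1, forall i, ~~ (nth false b i && nth false b i.+1)
       & forall i, nth false b i -> ascent v i]) ->
  #|[set wk_interval v w | w : 'S_n &
       `[< wk_le v w /\ boolean_poset (@wk_le n) (wk_interval v w) >]]|
  = size L.
Proof.
move=> uL LP.
pose G (b : bitseq) : {set 'S_n} := [set u | (inv v \subset inv u) &&
  (inv u \subset inv v :|: cover_inv v (nth false b))].
have G_interval w (b : bitseq) : inv w = inv v :|: cover_inv v (nth false b) ->
    wk_interval v w = G b.
  by move=> ew; apply/setP=> u; rewrite in_wk_interval ew /G in_set.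
have G_witness (b : bitseq) : b \in L ->
    exists2 w, w \in G b & inv w = inv v :|: cover_inv v (nth false b).
  case/LP=> _ nadj _; have [w ew] := exists_inv_setU_cover v nadj.
  by exists w; rewrite // /G in_set ew subsetUl subxx.
(* The pair of the ascent [i] is inverted by the top of [G b] but not by [v], so it must come from a
   bit of [b']. *)
have G_sub (b b' : bitseq) : b \in L -> b' \in L -> G b = G b' ->
    forall i, nth false b i -> nth false b' i.
  move=> bL b'L eG i bi.
  have [_ _ /(_ _ bi)/ascentP[x [y [xy vx vy]]]] := (LP b).1 bL.
  have [w] := G_witness _ bL; rewrite eG /G in_set => /andP[_ /subsetP sub] ew.
  have := sub (x, y); rewrite ew !in_setU.
  have vxy : v y = (v x).+1 :> nat by rewrite vx vy.
  by rewrite (negPf (notin_inv_cover vxy)) !in_cover_inv xy vxy eqxx vx bi => /(_ isT).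
have uG : uniq (map G L).
  rewrite map_inj_in_uniq // => b b' bL b'L eG.
  apply: (@eq_from_nth _ false) => [|i _].
    by have [-> _ _] := (LP b).1 bL; have [-> _ _] := (LP b').1 b'L.
  by apply/idP/idP; apply: G_sub.
rewrite -(size_map G) -(card_uniqP uG); apply: eq_card => I.
apply/imsetP/mapP => [[w]|[b bL ->]].
  rewrite inE => /asboolP[vw boolw] ->.
  have [J [Jasc nadj inv_w]] := boolean_wk_interval_cover vw boolw.
  (* Ascents are below [n.-1], so the default [false] past the end agrees with [J]. *)
  have nthJ i : nth false (mkseq J n.-1) i = J i.
    have [lt|ge] := ltnP i n.-1; first by rewrite nth_mkseq.
    rewrite nth_default ?size_mkseq //; apply/esym/negbTE.
    by apply: contraL ge => /Jasc/ascent_ltn; rewrite ltnNge.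
  exists (mkseq J n.-1).
    by apply/LP; split=> [|i|i]; rewrite ?size_mkseq // !nthJ //; apply: Jasc.
  apply: G_interval; rewrite inv_w; congr (_ :|: _).
  by apply/setP=> x; rewrite !inE nthJ.
have [w _ ew] := G_witness _ bL.
have [_ nadj _] := (LP b).1 bL.
exists w; last by rewrite (G_interval _ b).
rewrite inE; apply/asboolP; split; last exact: boolean_wk_interval ew.
by apply/wk_leP; rewrite ew subsetUl.
Qed.

Lemma ascent_sigma (k : gen n) i :
  ascent (sigma k) i = (i.+1 < n) && (i != (val k).-1).
Proof.
have k_gt0 : 0 < val k by case/andP: (valP k).
pose lo := Ordinal (gen_pred_ltn k); pose hi := Ordinal (gen_ltn k).
apply/ascentP/andP => [[a [b [ab sa sb]]]|[lt neq]].
  split; first by rewrite -sb ltn_ord.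
  apply/eqP=> ik; move: ab; rewrite -(tpermK lo hi a) -(tpermK lo hi b).
  have -> : tperm lo hi a = lo by apply: val_inj; rewrite /= sa ik.
  have -> : tperm lo hi b = hi by apply: val_inj; rewrite /= sb ik prednK.
  by rewrite tpermL tpermR /=; lia.
(* A transposition is its own inverse, so these are the positions of the values [i] and [i.+1]. *)
exists (sigma k (Ordinal (ltnW lt))), (sigma k (Ordinal lt)).
rewrite !tpermK; split=> //; move: neq k_gt0; rewrite /sigma.
have neqv (e f : 'I_n) : e <> f -> e <> f :> nat by move=> ne /val_inj.
case: tpermP => [/(congr1 val)|/(congr1 val)|/neqv + /neqv +] /=;
  case: tpermP => [/(congr1 val)|/(congr1 val)|/neqv + /neqv +] /=; lia.
Qed.

End Inversions.

(** * Counting binary words without adjacent ones *)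

Definition nonadjacent : bitseq -> bool := sorted (fun x y => ~~ (x && y)).

Lemma nonadjacentP b : reflect
  (forall i, ~~ (nth false b i && nth false b i.+1)) (nonadjacent b).
Proof.
apply: (iffP (sortedP false)) => nadj i //.
have [/nadj //|ge] := ltnP i.+1 (size b).
by rewrite (nth_default _ ge) andbF.
Qed.

Lemma nonadjacent_false b : nonadjacent (false :: b) = nonadjacent b.
Proof. by case: b. Qed.

(** A cleared bit is compatible with both neighbours, so the two sides are independent. *)
Lemma nonadjacent_cat_false a b :
  nonadjacent (a ++ false :: b) = nonadjacent a && nonadjacent b.
Proof.
case: a => [|x a]; first exact: nonadjacent_false.
have := nonadjacent_false b; rewrite /nonadjacent /= => path_false.
by rewrite cat_path /= andbF path_false.
Qed.

(** A longer word starts with [false] or with [true, false], which is the Fibonacci recursion; the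
    base cases have [fib 2] and [fib 3] words. *)
Fixpoint nonadjacent_words (m : nat) : seq bitseq :=
  match m with
  | 0 => [:: [::]]
  | p.+1 => match p with
    | 0 => [:: [:: false]; [:: true]]
    | q.+1 => map (cons false) (nonadjacent_words p)
              ++ map (fun b => [:: true, false & b]) (nonadjacent_words q)
    end
  end.

Lemma nonadjacent_wordsS m : nonadjacent_words m.+2 =
  map (cons false) (nonadjacent_words m.+1)
  ++ map (fun b => [:: true, false & b]) (nonadjacent_words m).
Proof. by []. Qed.

Lemma mem_nonadjacent_words m b :
  (b \in nonadjacent_words m) = (size b == m) && nonadjacent b.
Proof.
have cons_inj (c : bool) : injective (cons c) by move=> ? ? [].
have [p] := ubnP m; elim: p m b => // p IH [|[|m]] b lt.
- by rewrite inE; case: b.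
- by rewrite !inE; case: b => [|[] [|? ?]].
rewrite nonadjacent_wordsS mem_cat.
case: b => [|[] b].
- by rewrite orbC; apply/orP=> -[] /mapP[].
- have -> : (true :: b \in map (cons false) (nonadjacent_words m.+1)) = false.
    by apply/mapP=> -[].
  case: b => [|[] b].
  + by apply/mapP=> -[].
  + by rewrite /= andbF; apply/mapP=> -[].
  rewrite (mem_map (f := fun b => [:: true, false & b])); last by move=> ? ? [].
  have -> : nonadjacent [:: true, false & b] = nonadjacent b.
    exact: nonadjacent_false.
  by rewrite IH // -ltnS ltnW.
rewrite mem_map // IH ?nonadjacent_false //.
have -> : (false :: b \in
    map (fun b => [:: true, false & b]) (nonadjacent_words m)) = false.
  by apply/mapP=> -[].
by rewrite orbF.
Qed.

Lemma uniq_nonadjacent_words m : uniq (nonadjacent_words m).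
Proof.
have [p] := ubnP m; elim: p m => // p IH [|[|m]] // lt.
rewrite nonadjacent_wordsS cat_uniq; apply/and3P; split.
- by rewrite map_inj_uniq ?IH // => ? ? [].
- by apply/hasPn=> _ /mapP[b _ ->]; apply/mapP=> -[].
- by rewrite map_inj_uniq ?IH // => [|? ? []]; first exact: ltnW lt.
Qed.

Lemma size_nonadjacent_words m : size (nonadjacent_words m) = fib m.+2.
Proof.
have [p] := ubnP m; elim: p m => // p IH [|[|m]] // lt.
rewrite nonadjacent_wordsS size_cat !size_map !IH //.
exact: ltnW lt.
Qed.

(* The bit of index [i], which stands for the generator [i.+1], is cleared. *)
Definition split_words i j : seq bitseq :=
  [seq a ++ false :: b | a <- nonadjacent_words i, b <- nonadjacent_words j].

Lemma mem_split_words i j b : (b \in split_words i j) =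
  [&& size b == i + j.+1, nonadjacent b & ~~ nth false b i].
Proof.
apply/allpairsP/and3P => [[[a c] /= []]|[/eqP sz nadj bi]].
  rewrite !mem_nonadjacent_words => /andP[/eqP sa na] /andP[/eqP sc nc] ->.
  by rewrite size_cat nonadjacent_cat_false nth_cat /= sa sc na nc ltnn subnn.
have eb : b = take i b ++ false :: drop i.+1 b.
  rewrite -(negbTE bi) -drop_nth ?cat_take_drop //; lia.
move: nadj; rewrite {1}eb nonadjacent_cat_false => /andP[n1 n2].
exists (take i b, drop i.+1 b); split=> //=; rewrite mem_nonadjacent_words.
  by rewrite n1 size_takel ?eqxx //; lia.
by rewrite n2 size_drop sz andbT; lia.
Qed.

Lemma uniq_split_words i j : uniq (split_words i j).
Proof.
apply: allpairs_uniq; rewrite ?uniq_nonadjacent_words // => -[a b] [a' b'].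
move=> /allpairsP[[x y] /= [xin _ [-> ->]]] /allpairsP[[x' y'] /= [xin' _ [-> ->]]].
move: xin xin'; rewrite !mem_nonadjacent_words.
move=> /andP[/eqP sx _] /andP[/eqP sx' _] /eqP.
(* Both left parts have length [i], so the concatenation splits in only one way. *)
by rewrite eqseq_cat ?sx ?sx' // => /andP[/eqP -> /eqP [->]].
Qed.

Theorem proposition5p9 (n k : nat) (hk : 0 < k < n) :
  let s : 'S_n := sigma (exist _ k hk) in
  #|[set wk_interval s w | w : 'S_n &
       `[< wk_le s w /\ boolean_poset (@wk_le n) (wk_interval s w) >]]|
  = fib k.+1 * fib (n - k).+1.
Proof.
move=> s; have [k_gt0 kn] := andP hk.
(* The one non-ascent of [s] has index [k.-1], with [k.-1] bits before it and [n - k.+1] after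
   it. *)
rewrite (@card_boolean_wk_intervals _ s (split_words k.-1 (n - k.+1))).
- rewrite size_allpairs !size_nonadjacent_words prednK //.
  by rewrite -subSn // subSS.
- exact: uniq_split_words.
move=> b; rewrite mem_split_words.
have -> : k.-1 + (n - k.+1).+1 = n.-1 by lia.
split=> [/and3P[/eqP sz /nonadjacentP nadj bk]|[sz nadj asc]].
  split=> // i bi; rewrite ascent_sigma /=; apply/andP; split.
    have : i < size b by rewrite ltnNge; apply: contraL bi => /(nth_default false) ->.
    by rewrite sz; lia.
  by apply: contraNneq bk => <-.
apply/and3P; split; [exact/eqP|exact/nonadjacentP|].
by apply/negP=> /asc; rewrite ascent_sigma /= eqxx andbF.
Qed.
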